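(* Let $1\le c\le n-1$ and $\gamma<0$. For every connected graph $G$ of order $n$ with vertex connectivity $1\le\kappa(G)\le c$, \[{}^0R_{\gamma}(G)\le (n-1)+(n-1)^{\gamma},\] with equality if and only if $G=S_n$.
   Context: ${}^0R_{\gamma}(G)=\sum_{u\in V(G)} d(u)^{\gamma}$. Graphs are finite and simple. $\kappa(G)$ is vertex connectivity. $S_n$ is the star on $n$ vertices. *)

(* Defs.v *)
From HB Require Import structures.
From mathcomp Require Import all_boot all_order all_algebra.
From mathcomp Require Import all_reals.
From mathcomp Require Import exp.

Set Implicit Arguments.
Unset Strict Implicit.
Unset Printing Implicit Defensive.

Import Order.TTheory GRing.Theory Num.Theory.

Record sgraph := SGraph {
  vertex :> finType;
  adj : rel vertex;
  adj_sym : symmetric adj;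
  adj_irr : irreflexive adj }.

Definition degree (G : sgraph) (u : G) : nat := #|[set v | adj u v]|.

Definition adj_in (G : sgraph) (A : {set G}) : rel G :=
  [rel x y | [&& x \in A, y \in A & adj x y]].

(* Any two vertices of the induced subgraph on A are joined by a path inside
   A; vacuous for the empty set. *)
Definition connected_in (G : sgraph) (A : {set G}) : bool :=
  [forall x in A, forall y in A, connect (adj_in A) x y].

Definition connected (G : sgraph) : bool :=
  (0 < #|G|) && connected_in [set: G].

(* Deleting S leaves a disconnected graph or at most one vertex; the second
   clause gives complete graphs K_n the conventional connectivity n - 1. *)
Definition vertex_cut (G : sgraph) (S : {set G}) : bool :=
  (~~ connected_in (~: S)) || (#|~: S| <= 1).

(* The arg min is well defined since [set: G] is a vertex cut. *)
Definition kappa (G : sgraph) : nat :=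
  #|[arg min_(S < [set: G] | vertex_cut S) #|S|]|.

Definition isomorphic (G H : sgraph) : Prop :=
  exists2 f : G -> H, bijective f & forall x y, adj (f x) (f y) = adj x y.

Definition star_adj (n : nat) : rel 'I_n :=
  [rel i j : 'I_n | (i != j) && ((i == 0 :> nat) || (j == 0 :> nat))].

Lemma star_adj_sym n : symmetric (@star_adj n).
Proof. by move=> i j; rewrite /star_adj /= eq_sym orbC. Qed.

Lemma star_adj_irr n : irreflexive (@star_adj n).
Proof. by move=> i; rewrite /star_adj /= eqxx. Qed.

Definition star (n : nat) : sgraph :=
  SGraph (@star_adj_sym n) (@star_adj_irr n).

Local Open Scope ring_scope.

(* Pitfall: powR sends 0 to 0 for a nonzero exponent; this does not matter for
   graphs without isolated vertices. *)
Definition zeroth_randic (R : realType) (gamma : R) (G : sgraph) : R :=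
  \sum_(u : G) (degree u)%:R `^ gamma.

(* Main.v *)
Require Import Defs.
From HB Require Import structures.
From mathcomp Require Import all_boot all_order all_algebra.
From mathcomp Require Import all_reals.
From mathcomp Require Import exp.
From mathcomp Require Import perm zify ring.

Set Implicit Arguments.
Unset Strict Implicit.
Unset Printing Implicit Defensive.

Import Order.TTheory GRing.Theory Num.Theory.
Local Open Scope ring_scope.

(** Put [m = n - 1]. For [gamma < 0] the map [x |-> x ^ gamma] is decreasing and
    strictly convex, so on [[1, m]] it lies below its chord, strictly so inside
    the interval. Summing the chord bound over all degrees gives a decreasing
    affine function of the degree sum, and the degree sum of a connected graph
    is at least [2 m]; this is the inequality. Equality forces every degree to
    be [1] or [m] and the degree sum to be [2 m], so that some vertex is
    adjacent to all the others and these are leaves. *)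

Section Chord.
Variable R : realFieldType.
Implicit Types (f : R -> R) (a b x : R).

(* For [a = b] the quotient is [0], so that the chord is constant. *)
Definition chord f a b x : R := f a + (f b - f a) / (b - a) * (x - a).

Definition strictly_below_chord f a b : Prop := forall x, a <= x <= b ->
  f x <= chord f a b x ?= iff (x == a) || (x == b).

Lemma chord_left f a b : chord f a b a = f a.
Proof. by rewrite /chord subrr mulr0 addr0. Qed.

Lemma chord_right f a b : chord f a b b = f b.
Proof.
have [->|neq_ab] := eqVneq a b; first exact: chord_left.
by rewrite /chord divfK ?subr_eq0 1?eq_sym// addrC subrK.
Qed.

Lemma chord_weighted_mean f a b x : a != b ->
  chord f a b x = ((b - x) * f a + (x - a) * f b) / (b - a).
Proof. by move=> neq_ab; rewrite /chord; field; rewrite subr_eq0 eq_sym. Qed.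

Lemma sum_chord (I : finType) f a b (d : I -> R) :
  \sum_i chord f a b (d i) =
  f a *+ #|I| + (f b - f a) / (b - a) * (\sum_i d i - a *+ #|I|).
Proof. by rewrite big_split /= -mulr_sumr sumrB !sumr_const. Qed.

Section Sum.
Variables (I : finType) (f : R -> R) (a b : R) (d : I -> R).
Hypotheses (I_gt0 : (0 < #|I|)%N) (f_decr : f b <= f a ?= iff (a == b)).
Hypothesis d_itv : forall i, a <= d i <= b.
Hypothesis sum_ge : b + a *+ #|I|.-1 <= \sum_i d i.

Lemma leif_sum_chord :
  \sum_i chord f a b (d i) <= f b + f a *+ #|I|.-1
    ?= iff (b + a *+ #|I|.-1 == \sum_i d i).
Proof.
have mulrn_card (x : R) : x *+ #|I| = x + x *+ #|I|.-1.
  by rewrite -mulrS prednK.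
have [eq_ab|neq_ab] := eqVneq a b.
  have d_const i : d i = a by apply/le_anti; rewrite andbC {2}eq_ab d_itv.
  rewrite sum_chord -eq_ab subrr !mul0r addr0 (eq_bigr (fun=> a))//.
  by rewrite sumr_const !mulrn_card eqxx; apply/leif_refl.
have lt_ab : a < b.
  rewrite lt_def eq_sym neq_ab; have [i _] := card_gt0P I_gt0.
  by have /andP[/le_trans] := d_itv i; apply.
have slope_lt0 : (f b - f a) / (b - a) < 0.
  by rewrite pmulr_llt0 ?invr_gt0 ?subr_gt0// subr_lt0 (lt_leif f_decr).
have -> : \sum_i chord f a b (d i) = f b + f a *+ #|I|.-1
    + (f b - f a) / (b - a) * (\sum_i d i - (b + a *+ #|I|.-1)).
  by rewrite sum_chord !mulrn_card; field; rewrite subr_eq0 gt_eqF.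
apply/leifP; case: eqVneq => [->|neq_sum]; first by rewrite subrr mulr0 addr0.
by rewrite gtrDl nmulr_rlt0// subr_gt0 lt_neqAle neq_sum.
Qed.

Lemma leif_sum_below_chord : strictly_below_chord f a b ->
  \sum_i f (d i) <= f b + f a *+ #|I|.-1
    ?= iff [forall i, (d i == a) || (d i == b)]
           && (b + a *+ #|I|.-1 == \sum_i d i).
Proof.
move=> f_chord; apply: leif_trans leif_sum_chord.
by apply: leif_sum => i _; apply: f_chord.
Qed.

End Sum.
End Chord.

Lemma ln_lt_subr1 (R : realType) (y : R) : 0 < y -> y != 1 -> ln y < y - 1.
Proof.
move=> y_gt0 y_neq1; have : ln y != 0 by rewrite ln_eq0.
by move/expR_gt1Dx; rewrite lnK// ltrBrDl.
Qed.

Section NegativePower.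
Variables (R : realType) (g : R).
Hypothesis g_lt0 : g < 0.
Implicit Types (a b x y : R).

Lemma neg_powR_gt_bernoulli y : 0 < y -> y != 1 -> 1 + g * (y - 1) < y `^ g.
Proof.
move=> y_gt0 y_neq1; rewrite /powR gt_eqF//.
apply: lt_le_trans (expR_ge1Dx _).
by rewrite ltrD2l ltr_nM2l ?ln_lt_subr1.
Qed.

Lemma neg_powR_gt_tangent x y : 0 < x -> 0 < y -> y != x ->
  x `^ g * (1 + g * (y / x - 1)) < y `^ g.
Proof.
move=> x_gt0 y_gt0 neq_yx; have x_neq0 := lt0r_neq0 x_gt0.
have ratio_neq1 : y / x != 1.
  by rewrite -(divff x_neq0) (inj_eq (mulIf _)) ?invr_neq0.
have -> : y `^ g = x `^ g * (y / x) `^ g.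
  by rewrite -powRM ?divr_ge0 ?ltW// mulrC divfK.
by rewrite ltr_pM2l ?powR_gt0// neg_powR_gt_bernoulli ?divr_gt0.
Qed.

Lemma leif_neg_powR a b : 0 < a -> a <= b ->
  b `^ g <= a `^ g ?= iff (a == b).
Proof.
move=> a_gt0 le_ab; apply/leifP; case: eqVneq => [->//|neq_ab].
have b_gt0 : 0 < b := lt_le_trans a_gt0 le_ab.
rewrite -[g]opprK !(powRN _ (- g)) ltf_pV2 ?posrE ?powR_gt0//.
by apply: gt0_ltr_powR; rewrite ?oppr_gt0 ?nnegrE ?ltW// lt_neqAle neq_ab.
Qed.

(* The chord is a weighted mean of the values at [a] and [b]; both lie above the
   tangent at [x], whose weighted mean is its value at [x]. *)
Lemma neg_powR_strictly_below_chord a b : 0 < a ->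
  strictly_below_chord (fun x => x `^ g) a b.
Proof.
move=> a_gt0 x /andP[le_ax le_xb]; apply/leifP.
have [->|neq_xa] := eqVneq x a; first by rewrite chord_left /=.
have [->|neq_xb] := eqVneq x b; first by rewrite chord_right orbT.
have lt_ax : a < x by rewrite lt_def neq_xa.
have lt_xb : x < b by rewrite lt_neqAle neq_xb.
have [x_gt0 lt_ab] := (lt_trans a_gt0 lt_ax, lt_trans lt_ax lt_xb).
rewrite /= chord_weighted_mean ?lt_eqF// ltr_pdivlMr ?subr_gt0//.
have -> : x `^ g * (b - a) = (b - x) * (x `^ g * (1 + g * (a / x - 1)))
    + (x - a) * (x `^ g * (1 + g * (b / x - 1))).
  by field; rewrite gt_eqF.
apply: ltrD; rewrite ltr_pM2l ?subr_gt0// neg_powR_gt_tangent//.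
- by rewrite lt_eqF.
- exact: lt_trans lt_xb.
- by rewrite gt_eqF.
Qed.

End NegativePower.

Section DegreeSum.
Variable G : sgraph.
Implicit Types (u v x y : G) (A : {set G}).

Lemma degree_le_pred_card u : (degree u <= #|G|.-1)%N.
Proof.
rewrite -(cardsC1 u); apply/subset_leq_card/subsetP => v; rewrite !inE.
by apply: contraTneq => ->; rewrite adj_irr.
Qed.

Lemma connected_crossing_edge A u v : connected G -> u \in A -> v \notin A ->
  exists x y, [/\ x \in A, y \notin A & adj x y].
Proof.
move=> /andP[_ /forall_inP conn] uA vA.
have [/existsP[x /existsP[y /and3P[xA yA xy]]]|no_crossing] :=
  boolP [exists x, exists y, [&& x \in A, y \notin A & adj x y]].
  by exists x, y.
have adj_inC : connect_sym (adj_in [set: G]).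
  by apply: sym_connect_sym => x y; rewrite /adj_in /= !in_setT adj_sym.
have A_closed : closed (adj_in [set: G]) A.
  apply: (intro_closed adj_inC) => x y; rewrite /adj_in /= !in_setT => xy xA.
  apply: contraR no_crossing => yA; apply/existsP; exists x.
  by apply/existsP; exists y; rewrite xA yA.
have /forall_inP/(_ v (in_setT v)) := conn u (in_setT u).
by move/(closed_connect A_closed); rewrite uA (negbTE vA).
Qed.

Lemma connected_degree_gt0 u : connected G -> (1 < #|G|)%N -> (0 < degree u)%N.
Proof.
move=> conn G_gt1; have /card_gt0P[v] : (0 < #|[set~ u]|)%N.
  by rewrite cardsC1 -subn1 subn_gt0.
rewrite in_setC => vu.
have [x [y [/set1P-> _ uy]]] := connected_crossing_edge conn (set11 u) vu.
by rewrite card_gt0; apply/set0Pn; exists y; rewrite inE.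
Qed.

Definition arcs A : {set G * G} :=
  [set p | [&& p.1 \in A, p.2 \in A & adj p.1 p.2]].

Lemma sum_degree_card_arcs : (\sum_(u : G) degree u = #|arcs [set: G]|)%N.
Proof.
under eq_bigr do rewrite /degree -sum1_card.
rewrite pair_big_dep /= -sum1_card.
by apply: eq_bigl => p; rewrite !inE.
Qed.

Lemma card_arcsU1 A x y : x \in A -> y \notin A -> adj x y ->
  (#|arcs A| + 2 <= #|arcs (y |: A)|)%N.
Proof.
move=> xA yA xy; have xNy : x != y by apply: contraTneq xA => ->.
have -> : (#|arcs A| + 2 = #|arcs A :|: [set (x, y); (y, x)]|)%N.
  rewrite cardsU cards2 xpair_eqE (negbTE xNy) /=.
  rewrite disjoint_setI0 ?cards0 ?subn0//.
  rewrite disjoint_sym disjoint_subset; apply/subsetP => p /set2P[]->;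
    by rewrite !inE (negbTE yA) ?andbF.
apply/subset_leq_card/subsetP => p /setUP[|/set2P[]->]; rewrite !inE /=.
- by case/and3P=> -> -> ->; rewrite !orbT.
- by rewrite xA xy eqxx orbT.
- by rewrite adj_sym xA xy eqxx orbT.
Qed.

Lemma card_arcs_connected A : connected G -> A != set0 ->
  (#|arcs A| + #|~: A|.*2 <= #|arcs [set: G]|)%N.
Proof.
move=> conn; move cardA: #|~: A| => k.
elim: k A cardA => [|k IH] A cardA A_neq0.
  by rewrite addn0 -(setCK A) (cards0_eq cardA) setC0.
have [u uA] := set0Pn _ A_neq0.
have [v vA] : exists v, v \notin A.
  have /card_gt0P[v] : (0 < #|~: A|)%N by rewrite cardA.
  by rewrite inE; exists v.
have [x [y [xA yA xy]]] := connected_crossing_edge conn uA vA.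
have cardC_U1 : #|~: (y |: A)| = k.
  by have := cardsC A; have := cardsC (y |: A); rewrite cardsU1 yA cardA; lia.
have U1_neq0 : y |: A != set0 by apply/set0Pn; exists y; apply: setU11.
by have := IH _ cardC_U1 U1_neq0; have := card_arcsU1 xA yA xy; lia.
Qed.

Lemma connected_sum_degree_ge : connected G ->
  (#|G|.-1.*2 <= \sum_(u : G) degree u)%N.
Proof.
move=> conn; have /andP[/card_gt0P[u _] _] := conn.
have u_neq0 : [set u] != set0 by rewrite -card_gt0 cards1.
rewrite sum_degree_card_arcs -(cardsC1 u).
exact: leq_trans (leq_addl _ _) (card_arcs_connected conn u_neq0).
Qed.

End DegreeSum.

Section StarCenter.
Variable G : sgraph.
Implicit Types (u v x y : G).

Definition star_center u : bool :=
  [forall x, forall y, adj x y == (x != y) && ((x == u) || (y == u))].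

Lemma star_centerP u :
  reflect (forall x y, adj x y = (x != y) && ((x == u) || (y == u)))
          (star_center u).
Proof. by apply: (iffP 'forall_'forall_eqP). Qed.

Lemma degree_eq_pred_cardP u :
  reflect (forall x, adj u x = (x != u)) (degree u == #|G|.-1).
Proof.
have sub : [set v | adj u v] \subset [set~ u].
  by apply/subsetP => v; rewrite !inE; apply: contraTneq => ->; rewrite adj_irr.
rewrite -(cardsC1 u) /degree (eq_leqif (subset_leqif_cards sub)).
apply: (iffP eqP) => [/setP nbh x|nbh]; first by have := nbh x; rewrite !inE.
by apply/setP => x; rewrite !inE.
Qed.

Lemma degree_eq1P x u : adj x u ->
  reflect (forall y, adj x y = (y == u)) (degree x == 1%N).
Proof.
move=> xu; apply: (iffP cards1P) => [[v /setP nbh] y|nbh]; last first.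
  by exists u; apply/setP => y; rewrite !inE.
have adjE z : adj x z = (z == v) by have := nbh z; rewrite !inE.
by move: xu; rewrite !adjE => /eqP->.
Qed.

Lemma star_centerE u : star_center u =
  (degree u == #|G|.-1) && [forall (x | x != u), degree x == 1%N].
Proof.
apply/star_centerP/andP => [adjE|[/degree_eq_pred_cardP adj_u leaf] x y].
  split.
    by apply/degree_eq_pred_cardP => x; rewrite adjE eqxx andbT eq_sym.
  apply/forall_inP => x xu; apply/(@degree_eq1P _ u).
    by rewrite adjE eqxx orbT andbT.
  move=> y; rewrite adjE (negbTE xu) /=.
  by have [->|] := eqVneq y u; rewrite ?xu ?andbF.
have [->|xu] := eqVneq x u; first by rewrite adj_u eq_sym andbT.
have adj_xu : adj x u by rewrite adj_sym adj_u.
have /(degree_eq1P adj_xu) -> := forall_inP leaf x xu.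
by have [->|] := eqVneq y u; rewrite ?xu ?andbF.
Qed.

Lemma exists_star_centerE : (1 < #|G|)%N ->
  [exists u, star_center u] =
  [forall u : G, (degree u == 1%N) || (degree u == #|G|.-1)]
    && (#|G|.-1.*2 == \sum_(u : G) degree u)%N.
Proof.
move=> G_gt1; have sum1_neq u : (\sum_(x : G | x != u) 1 = #|G|.-1)%N.
  by rewrite sum1_card; apply: cardC1.
apply/existsP/andP => [[u]|[/forallP deg /eqP sum_deg]].
  rewrite star_centerE => /andP[/eqP deg_u /forall_inP leaf]; split.
    apply/forallP => x; have [->|/leaf->//] := eqVneq x u.
    by rewrite deg_u eqxx orbT.
  rewrite (bigD1 u)//= deg_u (eq_bigr (fun=> 1%N)) => [|x /leaf/eqP//].
  by rewrite sum1_neq addnn.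
have [u deg_u] : exists u : G, degree u == #|G|.-1.
  apply/existsP; apply: contra_eqT sum_deg; rewrite negb_exists => /forallP noc.
  have deg1 u : degree u = 1%N.
    by apply/eqP; have := deg u; rewrite (negbTE (noc u)) orbF.
  have [u _] := card_gt0P (ltnW G_gt1); have := noc u; rewrite deg1.
  under eq_bigr do rewrite deg1.
  by rewrite (bigD1 u)//= sum1_neq -addnn eqn_add2r eq_sym.
exists u; rewrite star_centerE deg_u.
have deg_ge1 x : x != u -> (1 <= degree x ?= iff (degree x == 1))%N.
  by move=> _; rewrite eq_sym; apply/leqif_eq; case/orP: (deg x) => /eqP; lia.
rewrite -(eq_leqif (leqif_sum deg_ge1)) sum1_neq.
by move/eqP: sum_deg; rewrite (bigD1 u)//= (eqP deg_u) -addnn eqn_add2l.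
Qed.

Lemma isomorphic_starP n : #|G| = n -> (0 < n)%N ->
  isomorphic G (star n) <-> [exists u, star_center u].
Proof.
case: n => // n cardG _; split=> [[f [f' fK f'K] f_adj]|/existsP[u]].
  apply/existsP; exists (f' ord0); apply/star_centerP => x y.
  rewrite -f_adj /= /star_adj /= (can_eq fK).
  by congr (_ && (_ || _)); rewrite -(can_eq fK) f'K.
move=> /star_centerP adjE.
pose rank x : 'I_n.+1 := cast_ord cardG (enum_rank x).
pose f x : 'I_n.+1 := tperm (rank u) ord0 (rank x).
have f_inj : injective f.
  by move=> x y /perm_inj/cast_ord_inj/enum_rank_inj.
have f_u : f u = ord0 by apply: tpermL.
exists (f : G -> star n.+1).
  by apply: inj_card_bij; rewrite ?cardG ?card_ord.
move=> x y; rewrite adjE /= /star_adj /= (inj_eq f_inj).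
suff f_eq0 z : (f z == 0 :> nat) = (z == u) by rewrite !f_eq0.
by rewrite -(inj_eq f_inj) f_u -val_eqE.
Qed.

End StarCenter.

Lemma leif_zeroth_randic (R : realType) (gamma : R) (G : sgraph) :
  gamma < 0 -> connected G -> (1 < #|G|)%N ->
  zeroth_randic gamma G <= (#|G|.-1)%:R + (#|G|.-1)%:R `^ gamma
    ?= iff [exists u : G, star_center u].
Proof.
move=> gamma_lt0 conn G_gt1; rewrite exists_star_centerE//.
have deg_itv (u : G) : 1 <= ((degree u)%:R : R) <= (#|G|.-1)%:R.
  by rewrite ler1n ler_nat connected_degree_gt0// degree_le_pred_card.
have sum_ge : (#|G|.-1)%:R + 1 *+ #|G|.-1 <= \sum_(u : G) (degree u)%:R :> R.
  by rewrite -natrD addnn -natr_sum ler_nat connected_sum_degree_ge.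
have decr : (#|G|.-1)%:R `^ gamma <= 1 `^ gamma ?= iff (1 == (#|G|.-1)%:R :> R).
  by apply: leif_neg_powR; rewrite // ler1n -subn1 subn_gt0.
have := @leif_sum_below_chord _ _ (fun x => x `^ gamma) _ _ _ (ltnW G_gt1)
  decr deg_itv sum_ge (neg_powR_strictly_below_chord gamma_lt0 ltr01).
rewrite powR1 addrC -natrD addnn -natr_sum eqr_nat.
by under eq_forallb do rewrite eqr_nat (eqr_nat R _ 1).
Qed.

Theorem theorem3p9 (R : realType) (n c : nat) (gamma : R)
    (hc : (1 <= c <= n - 1)%N) (hgamma : gamma < 0)
    (G : sgraph) (hn : #|G| = n) (hconn : connected G)
    (hkappa : (1 <= kappa G <= c)%N) :
  zeroth_randic gamma G <= (n%:R - 1) + (n%:R - 1) `^ gamma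
  /\ (zeroth_randic gamma G = (n%:R - 1) + (n%:R - 1) `^ gamma
      <-> isomorphic G (star n)).
Proof.
have n_gt1 : (1 < n)%N by lia.
rewrite (isomorphic_starP hn (ltnW n_gt1)).
have -> : n%:R - 1 = n.-1%:R :> R by rewrite -subn1 natrB// ltnW.
have := leif_zeroth_randic hgamma hconn; rewrite hn => /(_ n_gt1) bound.
by split; [exact: bound | rewrite -(eq_leif bound); split=> /eqP].
Qed.
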